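(* Let $G$ be a cubic (i.e., $3$-regular) multigraph with $n$ vertices and exactly $c$ cut-edges. Then $$f_2(G)\ge n-\max\left\{0,\left\lfloor \tfrac{c-1}{2}\right\rfloor\right\}.$$ Moreover, this bound is sharp: for every odd $c\ge 1$ there is a cubic graph with exactly $c$ cut-edges for which equality holds.
   Context: Multigraphs are finite and may have loops and multiple edges; a loop contributes $2$ to the degree of its vertex. A cut-edge is an edge whose deletion increases the number of connected components. A subgraph is $2$-regular if every vertex of it has degree $2$ in it (so a loop, or a pair of parallel edges, can form a cycle). For a multigraph $G$, $f_2(G)$ denotes the maximum number of vertices in a $2$-regular subgraph of $G$ (taken to be $0$ if $G$ has no $2$-regular subgraph). *)

(* Defs.v *)
From HB Require Import structures.
From mathcomp Require Import all_boot all_order all_algebra.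
Set Implicit Arguments.
Unset Strict Implicit.
Unset Printing Implicit Defensive.

(* Edges are unoriented: [src] and [tgt] merely list the two ends in some order,
   and no definition below depends on that order. *)
Record multigraph := Multigraph {
  vert : finType;
  edge : finType;
  src : edge -> vert;
  tgt : edge -> vert }.

Section Multigraph.
Variable G : multigraph.
Implicit Types (W : {set vert G}) (F : {set edge G}) (e : edge G) (v x y : vert G).

(* Degree in the spanning subgraph with edge set F; a loop is counted twice. *)
Definition deg F v : nat :=
  #|[set e in F | src e == v]| + #|[set e in F | tgt e == v]|.

Definition cubic : Prop := forall v, deg [set: edge G] v = 3.

Definition ends e : {set vert G} := [set src e; tgt e].

Definition simple_graph : Prop :=
  (forall e, src e != tgt e) /\ injective ends.

Definition adj F : rel (vert G) := fun x y =>
  [exists e in F, (src e == x) && (tgt e == y) || (src e == y) && (tgt e == x)].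

Definition num_components F : nat := n_comp (adj F) predT.

Definition cut_edges : {set edge G} :=
  [set e | num_components [set: edge G] < num_components [set~ e]].

Definition is_subgraph W F : bool :=
  [forall e in F, (src e \in W) && (tgt e \in W)].

Definition two_regular_subgraph W F : bool :=
  is_subgraph W F && [forall v in W, deg F v == 2].

(* The empty maximum is 0; the empty subgraph is also admitted, with 0 vertices. *)
Definition f2 : nat :=
  \max_(H : {set vert G} * {set edge G} | two_regular_subgraph H.1 H.2) #|H.1|.

End Multigraph.

(* Main.v *)
Require Import Defs.
From HB Require Import structures.
From mathcomp Require Import all_boot all_order all_algebra zify.
Set Implicit Arguments.
Unset Strict Implicit.
Unset Printing Implicit Defensive.
Import Order.TTheory GRing.Theory Num.Theory.

(** In a cubic multigraph a set of edges is the edge set of a 2-regular subgraph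
    exactly when all its degrees are even, and no even set contains a cut-edge.
    Deleting the cut-edges leaves bridgeless blocks; let [d_B] count the ends of
    cut-edges in the block [B].  A bridgeless multigraph has an even edge set
    containing at least 2/3 of its edges; by counting degrees, in [B] this leaves
    at most [d_B / 3] vertices uncovered, hence at most [(d_B - 1) / 2] when
    [d_B > 0].  The cut-edges form a forest on the blocks, so for [c > 0] at
    least [c + 1] blocks have [d_B > 0], while the [d_B] add up to [2 c]; summing
    gives the bound.

    The 2/3 statement follows from Sebo's proof of Seymour's theorem on T-joins.
    Take a largest even set [F] with complement [J] and subdivide every edge, so
    that the graph is bipartite; give weight -1 to [J] and +1 to [F], so that no
    even set has negative weight.  Let [P] be an edge set of least weight, then
    least size, with exactly two odd vertices, and let [b] be one of them.  Then
    [b] meets exactly one edge of [J], hence at least two of [F], and merging [b]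
    with its neighbours keeps all hypotheses.  Inductively [2 |J| <= |F|].

    For sharpness, hang copies of a subdivided [K4] on the leaves of a caterpillar
    with [k] inner vertices of degree 3: these meet only cut-edges, hence lie in
    no 2-regular subgraph, and there are [2 k + 1] cut-edges. *)

(** * Boundaries of edge sets modulo 2, and cuts *)

Section Boundary.
Variables (V E : finType) (s t : E -> V).
Implicit Types (D Q : {set E}) (S : {set V}) (e : E) (v x y : V).

(** With exclusive or a loop is incident to no vertex, which matches its even contribution to the
    degree. *)
Definition incident e v : bool := (s e == v) (+) (t e == v).

Definition boundary D v : bool := \big[addb/false]_(e in D) incident e v.

Definition crosses S e : bool := (s e \in S) (+) (t e \in S).

Lemma bd_setID D Q v : boundary D v = boundary (D :&: Q) v (+) boundary (D :\: Q) v.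
Proof. by rewrite /boundary (big_setID Q). Qed.

Lemma bd_setD D Q v : Q \subset D -> boundary (D :\: Q) v = boundary D v (+) boundary Q v.
Proof.
by move=> sQD; rewrite (bd_setID D Q) (setIidPr sQD) addbC addbA addbb.
Qed.

Lemma bd_setU D Q v : [disjoint D & Q] -> boundary (D :|: Q) v = boundary D v (+) boundary Q v.
Proof.
rewrite disjoint_sym => dDQ; rewrite (bd_setID _ D) setUK setDUl setDv set0U.
by rewrite (setDidPl dDQ).
Qed.

Lemma bd_set0 v : boundary set0 v = false.
Proof. by rewrite /boundary big_set0. Qed.

Lemma bd_set1 e v : boundary [set e] v = incident e v.
Proof. by rewrite /boundary big_set1. Qed.

Lemma bd_setU1 e D v : e \notin D -> boundary (e |: D) v = incident e v (+) boundary D v.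
Proof. by move=> eD; rewrite bd_setU ?bd_set1 // disjoints1. Qed.

Lemma bd_setD1 e D v : e \in D -> boundary (D :\ e) v = boundary D v (+) incident e v.
Proof. by move=> eD; rewrite bd_setD ?bd_set1 // sub1set. Qed.

Definition symdiff D Q := (D :\: Q) :|: (Q :\: D).

Lemma bd_symdiff D Q v : boundary (symdiff D Q) v = boundary D v (+) boundary Q v.
Proof.
rewrite bd_setU; last by rewrite -setI_eq0; apply/eqP/setP=> x; rewrite !inE; do 2!case: (_ \in _).
rewrite (bd_setID D Q) (bd_setID Q D) (setIC Q D).
by case: (boundary (D :&: Q) v); case: (boundary _ v); case: (boundary _ v).
Qed.

Lemma bd_inc D v : boundary D v -> exists2 e, e \in D & incident e v.
Proof.
move=> Dv; apply/exists_inP; apply: contraLR Dv.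
rewrite negb_exists_in => /forall_inP ninc.
by rewrite /boundary big1 // => e /ninc /negbTE.
Qed.

Lemma bd_noinc D v : (forall e, e \in D -> ~~ incident e v) -> boundary D v = false.
Proof. by move=> h; apply/negP => /bd_inc[e /h/negP]. Qed.

Lemma bd_only D v e0 : e0 \in D -> incident e0 v ->
  (forall e, e \in D -> incident e v -> e = e0) -> boundary D v.
Proof.
move=> De0 i0 only; rewrite /boundary (bigD1 e0) //= i0 big1 // => e /andP[De ne].
by apply/negbTE/negP => /(only _ De) eq; rewrite eq eqxx in ne.
Qed.

Lemma inc_other e v : incident e v ->
  exists2 u, u != v & forall x, incident e x = (x == v) (+) (x == u).
Proof.
rewrite /incident; have [<-|nsv] := eqVneq (s e) v.
  by rewrite addTb => ntv; exists (t e) => // x; rewrite ![_ == x]eq_sym.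
rewrite addFb => /eqP tv; exists (s e) => // x.
by rewrite tv addbC ![_ == x]eq_sym.
Qed.

Lemma inc_pair e v u : v != u -> incident e v -> incident e u ->
  forall x, incident e x = (x == v) (+) (x == u).
Proof.
move=> nvu /inc_other[u' nu' eq]; rewrite eq eq_sym (negbTE nvu) /= => /eqP ->.
exact: eq.
Qed.

Lemma cross_inc S e u v : u != v -> incident e u -> incident e v -> crosses S e ->
  (v \in S) = (u \notin S).
Proof.
rewrite /incident /crosses => nuv; have [->|nsu] := eqVneq (s e) u.
  rewrite (negbTE nuv) addFb => _ /eqP ->.
  by case: (u \in S); case: (v \in S).
rewrite addFb => /eqP tu; rewrite tu (negbTE nuv) addbF => /eqP ->.
by case: (u \in S); case: (v \in S).
Qed.

(** Once the sums are exchanged, an edge with both ends in [S] is counted twice and cancels. *)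
Lemma big_bd S D :
  \big[addb/false]_(v in S) boundary D v = \big[addb/false]_(e in D) crosses S e.
Proof.
rewrite /boundary exchange_big; apply: eq_bigr => e _ /=.
rewrite big_split /=; congr (_ (+) _); rewrite big_mkcond /=.
  rewrite (bigD1 (s e)) //= eqxx big1 ?addbF; first by case: ifP.
  by move=> v; rewrite eq_sym => /negbTE ->; case: ifP.
rewrite (bigD1 (t e)) //= eqxx big1 ?addbF; first by case: ifP.
by move=> v; rewrite eq_sym => /negbTE ->; case: ifP.
Qed.

Lemma even_cross S D : boundary D =1 xpred0 ->
  \big[addb/false]_(e in D) crosses S e = false.
Proof. by move=> ev; rewrite -big_bd big1 // => v _; rewrite ev. Qed.

Lemma cross_setT e : crosses setT e = false.
Proof. by rewrite /crosses !inE. Qed.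

Lemma handshake D : \big[addb/false]_v boundary D v = false.
Proof.
transitivity (\big[addb/false]_(v in [set: V]) boundary D v).
  by apply: eq_bigl => v; rewrite inE.
by rewrite big_bd big1 // => e _; apply: cross_setT.
Qed.

Lemma odd_big_addb D (p : pred E) :
  \big[addb/false]_(e in D) p e = odd #|[set e in D | p e]|.
Proof.
rewrite -sum1_card big_mkcond [in RHS]big_mkcond /=.
rewrite (big_morph odd oddD (erefl : odd 0 = false)).
by apply: eq_bigr => e _; rewrite !inE; case: (e \in D); case: (p e).
Qed.

Lemma even_card_bipartite D S : boundary D =1 xpred0 ->
  (forall e, e \in D -> crosses S e) -> ~~ odd #|D|.
Proof.
move=> /(even_cross S) + Dc; rewrite odd_big_addb.
suff -> : [set e in D | crosses S e] = D by move->.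
by apply/setP => e; rewrite inE; case: (boolP (e \in D)) => //= /Dc.
Qed.

(** Walk away from [x] along an edge [e] of [D]: its other end [z] is odd in [D], or else becomes
    odd in [D :\ e], and the walk goes on from [z] in this smaller set. *)
Lemma bd_partner D x : boundary D x ->
  exists y Q, [/\ y != x, boundary D y, Q \subset D
                & forall v, boundary Q v = (v == x) (+) (v == y)].
Proof.
elim: {D}_.+1 {-2}D (ltnSn #|D|) x => // n IHn D; rewrite ltnS => leDn x Dx.
have [e De ex] := bd_inc Dx; have [z nzx eq] := inc_other ex.
case: (boolP (boundary D z)) => [Dz|nDz].
  by exists z, [set e]; split; rewrite ?sub1set // => v; rewrite bd_set1.
have De1 : #|D :\ e| < n by rewrite (cardsD1 e) De in leDn.
have bdz : boundary (D :\ e) z by rewrite bd_setD1 // (negbTE nDz) eq (negbTE nzx) eqxx.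
have [y [Q [nyz Dy sQ bQ]]] := IHn _ De1 _ bdz.
have nyx : y != x.
  by apply: contraTneq Dy => ->; rewrite bd_setD1 // Dx eq eqxx (eq_sym x z) (negbTE nzx).
exists y, (e |: Q); split=> //.
- by move: Dy; rewrite bd_setD1 // eq (negbTE nyx) (negbTE nyz) !addbF.
- by rewrite subUset sub1set De (subset_trans sQ) ?subD1set.
move=> v; rewrite bd_setU1 ?eq ?bQ; last by apply: contraTN isT => /(subsetP sQ); rewrite !inE eqxx.
by case: (v == x); case: (v == z); case: (v == y).
Qed.

End Boundary.

(** * Signed weights of edge sets *)

Section Weight.
Variables (E : finType) (J : {set E}).
Implicit Types (D Q : {set E}) (e : E).
Local Open Scope ring_scope.

(** Equals [#|D :\: J| - #|D :&: J|]. *)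
Definition weight D : int := #|D|%:Z - (2 * #|D :&: J|)%:Z.

Lemma wt_setID D Q : weight D = weight (D :&: Q) + weight (D :\: Q).
Proof.
rewrite /weight -(cardsID Q D) -(cardsID Q (D :&: J)).
have -> : D :&: J :&: Q = D :&: Q :&: J by rewrite setIAC.
have -> : (D :&: J) :\: Q = (D :\: Q) :&: J by rewrite setIDAC.
lia.
Qed.

Lemma wt_setD D Q : Q \subset D -> weight (D :\: Q) = weight D - weight Q.
Proof. by move=> sQD; rewrite (wt_setID D Q) (setIidPr sQD); lia. Qed.

Lemma wt_setU D Q : [disjoint D & Q] -> weight (D :|: Q) = weight D + weight Q.
Proof.
move=> dDQ; rewrite (wt_setID _ D) setUK setDUl setDv set0U.
by rewrite disjoint_sym in dDQ; rewrite (setDidPl dDQ).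
Qed.

Lemma wt_set1 e : weight [set e] = if e \in J then -1 else 1.
Proof.
rewrite /weight cards1; case: ifP => eJ.
  by rewrite (setIidPl _) ?sub1set // cards1.
by rewrite (_ : _ :&: _ = set0) ?cards0 //; apply/setP=> x; rewrite !inE; case: eqP => // ->.
Qed.

End Weight.

(** * Conservative weights and joins of least weight *)

Section Conservative.
Variables (V E : finType) (s t : E -> V) (A J : {set E}) (col : {set V}).
Implicit Types (D P Q : {set E}) (e : E) (v x y a b : V).
Local Notation inc := (incident s t).
Local Notation bd := (boundary s t).
Local Notation wt := (weight J).
Local Open Scope ring_scope.

Definition conservative : Prop := forall D, D \subset A -> bd D =1 xpred0 -> 0 <= wt D.

Hypothesis JA : J \subset A.
Hypothesis colA : forall e, e \in A -> crosses s t col e.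
Hypothesis cons : conservative.

(** A T-join for the pair [a], [b]; the case [a = b] is allowed and gives the even subsets of
    [A]. *)
Definition is_join a b P := P \subset A /\ forall v, bd P v = (v == a) (+) (v == b).

Lemma inc_nonloop e : e \in A -> s e != t e.
Proof. by move/colA; apply: contraTneq; rewrite /crosses => ->; rewrite addbb. Qed.

(** A single edge of [J] is a join of weight -1, so the least weight is negative. Joins with
    [a' = b'] are even, hence of nonnegative weight, and cannot compete. *)
Lemma min_join : J != set0 -> exists a b P, [/\ a != b, is_join a b P, wt P < 0 &
  forall a' b' Q, is_join a' b' Q -> wt P < wt Q \/ wt P = wt Q /\ (#|P| <= #|Q|)%N].
Proof.
case/set0Pn=> e eJ; have eA := subsetP JA e eJ.
pose pr (P : {set E}) := (P \subset A) && [exists a, exists b, (a != b) &&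
  [forall v, bd P v == ((v == a) (+) (v == b))]].
(* Sizes stay below [#|E|.+1], so [Phi] compares weights first and sizes second. *)
pose Phi P := wt P * (#|E|.+1)%:Z + #|P|%:Z.
have pr1 : pr [set e].
  rewrite /pr sub1set eA; apply/existsP; exists (s e); apply/existsP; exists (t e).
  rewrite inc_nonloop //=; apply/forallP => v; rewrite bd_set1 /incident.
  by rewrite !(eq_sym v).
case: (Order.TotalTheory.arg_minP Phi pr1) => P /andP[PA /existsP[a /existsP[b /andP[nab /forallP bP]]]] minP.
have lex Q : pr Q -> wt P < wt Q \/ wt P = wt Q /\ (#|P| <= #|Q|)%N.
  move=> /minP; rewrite /Phi => le.
  have := max_card (mem Q); have := max_card (mem P); move: le.
  move: (wt P) (wt Q) #|P| #|Q| #|E| => p q m n N; nia.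
exists a, b, P; split=> //.
- by split=> // v; apply/eqP.
- by case: (lex _ pr1); rewrite wt_set1 eJ; lia.
move=> a' b' Q [QA bQ]; have [eq|ne] := eqVneq a' b'.
  have : 0 <= wt Q by apply: cons => // v; rewrite bQ eq addbb.
  by case: (lex _ pr1); rewrite wt_set1 eJ; lia.
apply: lex; rewrite /pr QA; apply/existsP; exists a'; apply/existsP; exists b'.
by rewrite ne; apply/forallP => v; rewrite bQ.
Qed.

End Conservative.

(** * Structure of a least join, after Sebo *)

Section Extremal.
Variables (V E : finType) (s t : E -> V) (A J : {set E}) (col : {set V}).
Implicit Types (D Q R : {set E}) (e : E) (v x y : V).
Local Notation inc := (incident s t).
Local Notation bd := (boundary s t).
Local Notation wt := (weight J).
Local Notation join := (is_join s t A).
Local Open Scope ring_scope.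

Hypothesis colA : forall e, e \in A -> crosses s t col e.
Hypothesis cons : conservative s t A J.

Variables (a b : V) (P : {set E}).
Hypotheses (nab : a != b) (joinP : join a b P) (wtP : wt P < 0).
Hypothesis minP : forall a' b' Q, join a' b' Q ->
  wt P < wt Q \/ wt P = wt Q /\ (#|P| <= #|Q|)%N.

Let PA : P \subset A. Proof. by case: joinP. Qed.
Let bdP v : bd P v = (v == a) (+) (v == b). Proof. by case: joinP. Qed.

(** Toggling [e] in [P] moves the end [b] of the join to the other end of [e]; the weight would drop
    by 1 if [e] were in only one of [P] and [J]. *)
Lemma min_join_end_mem e : e \in A -> inc e b -> (e \in P) = (e \in J).
Proof.
move=> eA eb; have [u nub eq] := inc_other eb.
have [eP|eP] := boolP (e \in P).
  have /minP : join a u (P :\ e).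
    split=> [|v]; first by rewrite (subset_trans _ PA) ?subD1set.
    by rewrite bd_setD1 // bdP eq; case: (v == a); case: (v == b); case: (v == u).
  by rewrite wt_setD ?sub1set // wt_set1; case: ifP => // _; lia.
have /minP : join a u (e |: P).
  split=> [|v]; first by rewrite subUset sub1set eA.
  by rewrite bd_setU1 // bdP eq; case: (v == a); case: (v == b); case: (v == u).
by rewrite wt_setU ?disjoints1 // wt_set1; case: ifP => // _; lia.
Qed.

(** By conservativity, removing an even [D] does not raise the weight of [P], but it shrinks [P]
    unless [D] is empty. *)
Lemma min_join_acyclic D : D \subset P -> bd D =1 xpred0 -> D = set0.
Proof.
move=> DP evD; have wD := cons (subset_trans DP PA) evD.
have /minP : join a b (P :\: D).
  split=> [|v]; first by rewrite (subset_trans _ PA) ?subsetDl.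
  by rewrite bd_setD // bdP evD addbF.
rewrite wt_setD // cardsD (setIidPr DP); have := subset_leq_card DP.
by move=> le [|[_ le']]; [lia|]; apply/eqP; rewrite -cards_eq0; lia.
Qed.

Lemma min_join_min R : R \subset P -> (forall v, bd R v = (v == a) (+) (v == b)) -> P = R.
Proof.
move=> RP bR; apply/eqP; rewrite eqEsubset RP andbT -setD_eq0; apply/eqP.
by apply: min_join_acyclic => [|v]; rewrite ?subsetDl // bd_setD // bdP bR addbb.
Qed.

(** [P] behaves as a path ending in [b]. If it had a second edge at [b], follow [P] through [e0]
    away from [b]: reaching [a] gives a smaller join inside [P], and reaching another neighbour of
    [b] closes a cycle inside [P]. *)
Lemma min_join_end : exists2 e0, [/\ e0 \in P, e0 \in J & inc e0 b] &
  forall e, e \in P -> inc e b -> e = e0.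
Proof.
have bPb : bd P b by rewrite bdP eqxx eq_sym (negbTE nab).
have [e0 e0P e0b] := bd_inc bPb; exists e0.
  by split=> //; rewrite -min_join_end_mem // (subsetP PA).
move=> e eP eb; apply/eqP/idPn => ne.
have [u nub eq0] := inc_other e0b.
have [eua|nua] := eqVneq u a.
  have P1 : P = [set e0].
    by apply: min_join_min; rewrite ?sub1set // => v; rewrite bd_set1 eq0 eua addbC.
  by move: eP; rewrite P1 inE (negbTE ne).
pose P0 := P :\: [set e | inc e b].
have noPar f : f \in P -> inc f b -> inc f u -> f = e0.
  move=> fP fb fu; apply/eqP/idPn => nf.
  have bu : b != u by rewrite eq_sym.
  have : [set f; e0] = set0.
    apply: min_join_acyclic => [|v]; first by rewrite subUset !sub1set fP.
    by rewrite bd_setU1 ?inE // bd_set1 eq0 (inc_pair bu fb fu) addbb.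
  by move/setP/(_ f); rewrite !inE eqxx.
have bP0 v : bd P0 v = bd P v (+) bd (P :&: [set e | inc e b]) v.
  by rewrite (bd_setID _ _ P [set e | inc e b]) addbAC addbb.
have bP0b : bd P0 b = false by apply: bd_noinc => f; rewrite !inE => /andP[].
have bP0u : bd P0 u.
  rewrite bP0 bdP (negbTE nua) (negbTE nub) /=.
  apply: (@bd_only _ _ _ _ _ _ e0); first by rewrite !inE e0P.
    by rewrite eq0 eqxx (negbTE nub).
  by move=> f; rewrite !inE => /andP[fP fb]; apply: noPar.
have [y [Q [nyu P0y sQ bQ]]] := bd_partner bP0u.
have QP : Q \subset P by rewrite (subset_trans sQ) ?subsetDl.
have Qinc f : inc f b -> f \notin Q.
  by move=> fb; apply/negP => /(subsetP sQ); rewrite !inE fb.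
have [eya|nya] := eqVneq y a.
  have PQ : P = e0 |: Q.
    apply: min_join_min => [|v]; first by rewrite subUset sub1set e0P.
    rewrite bd_setU1 ?Qinc // eq0 bQ eya.
    by case: (v == a); case: (v == b); case: (v == u).
  by move: eP; rewrite PQ !inE (negbTE ne) (negbTE (Qinc _ eb)).
have nyb : y != b by apply: contraTneq P0y => ->; rewrite bP0b.
(* [y] is odd in [P0] but not in [P], so a deleted edge [f] joins it to [b]. *)
move: P0y; rewrite bP0 bdP (negbTE nya) (negbTE nyb) /= => /bd_inc[f].
rewrite !inE => /andP[fP fb] fy.
have nf : f != e0.
  by apply: contraTneq fy => ->; rewrite eq0 (negbTE nyu) (negbTE nyb).
have : f |: (e0 |: Q) = set0.
  apply: min_join_acyclic => [|v]; first by rewrite !subUset !sub1set fP e0P.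
  rewrite !bd_setU1 ?inE ?negb_or ?nf ?Qinc // eq0 bQ.
  rewrite eq_sym in nyb; rewrite (inc_pair nyb fb fy).
  by case: (v == y); case: (v == b); case: (v == u).
by move/setP/(_ f); rewrite !inE eqxx.
Qed.

(** Holds of [b] itself as soon as an edge of [A] is incident to [b]. *)
Definition nbr v := [exists e in A, inc e b && inc e v].

(* Conservativity is inherited by the graph in which [b] is merged with all its
   neighbours: [D] is even there exactly when its boundary lies in [nbr]. *)
Lemma min_join_contract D : D \subset A -> (forall e, e \in D -> ~~ inc e b) ->
  (forall v, bd D v -> nbr v) -> 0 <= wt D.
Proof.
elim: {D}_.+1 {-2}D (ltnSn #|D|) => // n IHn D; rewrite ltnS => leDn DA Db bdD.
rewrite leNgt; apply/negP => wD.
have [x Dx|evD] := pickP (bd D); last by have := cons DA evD; rewrite leNgt wD.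
have bdDb : bd D b = false by apply: bd_noinc.
have [y [Q [nyx Dy sQ bQ]]] := bd_partner Dx.
have small D' : D' \subset D -> D' != D -> (forall v, bd D' v -> nbr v) -> 0 <= wt D'.
  move=> sD nD bD; apply: IHn => //.
  - by rewrite (leq_trans _ leDn) // proper_card // properEneq nD.
  - exact: subset_trans DA.
  by move=> e /(subsetP sD); apply: Db.
have nbx := bdD _ Dx; have nby := bdD _ Dy.
have {nbx} [e1 e1A /andP[e1b e1x]] := exists_inP nbx.
have {nby} [e2 e2A /andP[e2b e2y]] := exists_inP nby.
have nbx : b != x by apply: contraTneq Dx => <-; rewrite bdDb.
have nby : b != y by apply: contraTneq Dy => <-; rewrite bdDb.
have eq1 := inc_pair nbx e1b e1x; have eq2 := inc_pair nby e2b e2y.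
have bQD v : bd Q v -> nbr v.
  by rewrite bQ; case: eqP => [-> _|_]; [exact: bdD | case: eqP => // -> _; exact: bdD].
(* A minimal counterexample is a single join of [x] and [y]: otherwise [Q] and [D :\: Q] are both
   smaller, and their nonnegative weights add up to that of [D]. *)
have DQ : D = Q.
  apply/eqP/idPn; rewrite eq_sym => nQD; have wQ := small Q sQ nQD bQD.
  have : 0 <= wt (D :\: Q).
    apply: small; rewrite ?subsetDl //.
      apply: contraTneq (Dx) => /setP DQ; apply: contraT; rewrite negbK => _.
      have : bd Q x by rewrite bQ eqxx eq_sym (negbTE nyx).
      move=> /bd_inc[e eQ _]; have := DQ e.
      by rewrite !inE eQ (subsetP sQ).
    move=> v; rewrite bd_setD //.
    by case: (boolP (bd Q v)) => [/bQD //|_]; rewrite addbF; apply: bdD.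
  by rewrite wt_setD //; clear - wD wQ; lia.
move: bQ; rewrite -DQ => bD {Q sQ bQD DQ}.
have ne12 : e2 != e1.
  apply: contraTneq e2y => ->; rewrite eq1 (negbTE nyx).
  by rewrite eq_sym (negbTE nby).
have e1D : e1 \notin D by apply: contraL e1b; apply: Db.
have e2D : e2 \notin D by apply: contraL e2b; apply: Db.
pose D0 := e1 |: (e2 |: D).
have e1D' : e1 \notin e2 |: D by rewrite !inE negb_or eq_sym ne12.
have D0A : D0 \subset A by rewrite !subUset !sub1set e1A e2A.
have evD0 : bd D0 =1 xpred0.
  move=> v; rewrite !bd_setU1 // eq1 eq2 bD.
  by case: (v == x); case: (v == y); case: (v == b).
have wD0 := cons D0A evD0.
have oD0 : ~~ odd #|D0|.
  by apply: (even_card_bipartite (S := col) evD0) => e /(subsetP D0A)/colA.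
have wD0E : wt D0 = wt [set e1] + (wt [set e2] + wt D).
  by rewrite !wt_setU ?disjoints1.
(* The closure [D0] of [D] through [b] has nonnegative weight and, by bipartiteness, even size. So
   the negative weight of [D] is even, and two further edges can compensate it only if it is -2 and
   both have weight +1. *)
have [wD2 e1J e2J] : [/\ wt D = -2, e1 \notin J & e2 \notin J].
  move: wD0; rewrite wD0E !wt_set1; move: oD0; rewrite !cardsU1 e1D' e2D !add1n /= negbK.
  have : exists k, wt D = #|D|%:Z - 2 * k%:Z by exists #|D :&: J|; rewrite /weight PoszM.
  by case=> k; move: (wt D) #|D| wD => w m; clear; case: ifP; case: ifP; split=> //; lia.
have {wD0E} wD0E : wt D0 = 0.
  by rewrite wD0E !wt_set1 (negbTE e1J) (negbTE e2J) wD2.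
have [e0 [e0P e0J e0b] e0u] := min_join_end.
have e1P : e1 \notin P by rewrite min_join_end_mem.
have e0D0 : e0 \notin D0.
  rewrite !inE !negb_or; apply/and3P; split.
  - by apply: contraNneq e1J => <-.
  - by apply: contraNneq e2J => <-.
  - by apply: contraL e0b; apply: Db.
(* [D0] is connected. Its edges off the component [K] of [b] form an even set [D4] contained in [D];
   if it were nonempty, [D4] and [D :\: D4] would both have nonnegative weight. *)
have circuit g v : g \in D0 -> inc g v ->
    exists2 D1 : {set E}, D1 \subset D0 & forall z, bd D1 z = (z == b) (+) (z == v).
  pose K := [set z | [exists D1 : {set E}, (D1 \subset D0) &&
    [forall z', bd D1 z' == ((z' == b) (+) (z' == z))]]].
  have KP z : reflect (exists2 D1 : {set E}, D1 \subset D0 &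
      forall z', bd D1 z' = (z' == b) (+) (z' == z)) (z \in K).
    rewrite inE; apply: (iffP existsP) => [[D1 /andP[sD1 /forallP h]]|[D1 sD1 h]].
      by exists D1 => // z'; apply/eqP.
    by exists D1; rewrite sD1; apply/forallP => z'; rewrite h.
  have Kb : b \in K by apply/KP; exists set0; rewrite ?sub0set // => z; rewrite bd_set0 addbb.
  have Kstep e u1 u2 : e \in D0 -> (forall z, inc e z = (z == u1) (+) (z == u2)) -> u1 \in K -> u2 \in K.
    move=> eD0 eqe /KP[D1 sD1 h]; apply/KP; exists (symdiff D1 [set e]).
      by rewrite subUset (subset_trans (subsetDl _ _) sD1) (subset_trans (subsetDl _ _)) ?sub1set.
    by move=> z; rewrite bd_symdiff h bd_set1 eqe; case: (z == b); case: (z == u1); case: (z == u2).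
  have Kst e : e \in D0 -> (s e \in K) = (t e \in K).
    move=> eD0; apply/idP/idP; apply: (Kstep e) => // z; rewrite /incident ![_ == z]eq_sym //.
    by rewrite addbC.
  have Kinc e z : e \in D0 -> inc e z -> (s e \in K) = (z \in K).
    move=> eD0; rewrite /incident; case: eqP => [->//|_]; case: eqP => [<- _|//].
    exact: Kst.
  pose D4 := [set e in D0 | s e \notin K].
  have D40 : D4 = set0.
    have D4D : D4 \subset D.
      apply/subsetP => e; rewrite in_set => /andP[eD0 nK].
      have neb : ~~ inc e b by apply: contra nK => /(Kinc _ _ eD0) ->.
      move: eD0; rewrite !in_setU1 => /orP[/eqP ee|/orP[/eqP ee|//]].
        by rewrite ee e1b in neb.
      by rewrite ee e2b in neb.
    have D4D0 : D4 \subset D0 by apply/subsetP => e; rewrite inE => /andP[].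
    have evD4 : bd D4 =1 xpred0.
      move=> z; have [Kz|Kz] := boolP (z \in K).
        apply: bd_noinc => e; rewrite in_set => /andP[eD0].
        by apply: contra => /(Kinc _ _ eD0) ->.
      rewrite -(evD0 z); have -> : bd D0 z = bd D4 z (+) bd (D0 :\: D4) z.
        by rewrite bd_setD // addbC -addbA addbb addbF.
      rewrite (@bd_noinc _ _ _ _ (D0 :\: D4)) ?addbF // => e.
      rewrite in_setD in_set => /andP[+ eD0]; rewrite eD0 /= negbK.
      by apply: contraL => /(Kinc _ _ eD0) ->.
    apply/eqP/idPn => nD4; have wD4 := cons (subset_trans D4D DA) evD4.
    have : 0 <= wt (D :\: D4).
      apply: small; rewrite ?subsetDl //.
        apply: contra nD4 => /eqP/setP h; apply/eqP/setP => e; have := h e.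
        rewrite in_setD in_set0; case: (boolP (e \in D4)) => //= eD4.
        by rewrite (subsetP D4D).
      by move=> z; rewrite bd_setD // evD4 addbF; apply: bdD.
    by rewrite wt_setD //; clear - wD wD4; lia.
  move=> gD0 gv; apply/KP; rewrite -(Kinc g) //; apply/idPn => gK.
  by move/setP/(_ g): D40; rewrite in_set in_set0 gD0 gK.
(* [R] keeps [e0], the only edge of [P] at [b]; [R1] leads from [b] to another odd vertex [z] of
   [R]. *)
pose R := P :\: D0.
have Rb : bd R b.
  apply: (@bd_only _ _ _ _ _ _ e0) => //; first by rewrite inE e0P e0D0.
  by move=> e; rewrite in_setD => /andP[_]; apply: e0u.
have [z [R1 [nzb Rz sR1 bR1]]] := bd_partner Rb.
have R1P : R1 \subset P by rewrite (subset_trans sR1) ?subsetDl.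
have R1D0 D1 : D1 \subset D0 -> [disjoint R1 & D1].
  move=> sD1; rewrite disjoints_subset; apply/subsetP => e /(subsetP sR1).
  by rewrite in_setD in_setC => /andP[eD0 _]; apply: contra eD0; apply/subsetP.
have R1A := subset_trans R1P PA.
(* If [z] lies on [D0], then [D1] and [D0 :\: D1] both close [R1] to an even set. Their weights are
   opposite, so [R1] has nonnegative weight and [P :\: R1] is a smaller join of no greater
   weight. *)
have [/exists_inP[g gD0 gz]|noinc] := boolP [exists g in D0, inc g z].
  have [D1 sD1 bD1] := circuit g z gD0 gz.
  have wR1 D' : D' \subset D0 -> (forall v, bd D' v = (v == b) (+) (v == z)) -> 0 <= wt R1 + wt D'.
    move=> sD' bD'; rewrite -wt_setU ?R1D0 //; apply: cons => [|v].
      by rewrite subUset R1A (subset_trans sD').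
    by rewrite bd_setU ?R1D0 // bR1 bD' addbb.
  have w1 := wR1 _ sD1 bD1.
  have w2 : 0 <= wt R1 + wt (D0 :\: D1).
    by apply: wR1 => [|v]; rewrite ?subsetDl // bd_setD // evD0 bD1.
  rewrite wt_setD // wD0E in w2.
  have /minP : join a z (P :\: R1).
    split=> [|v]; first by rewrite (subset_trans _ PA) ?subsetDl.
    by rewrite bd_setD // bdP bR1; case: (v == a); case: (v == b); case: (v == z).
  rewrite wt_setD // cardsD (setIidPr R1P).
  have : (0 < #|R1|)%N.
    rewrite card_gt0; apply/set0Pn.
    have : bd R1 b by rewrite bR1 eqxx eq_sym (negbTE nzb).
    by case/bd_inc=> e eR1 _; exists e.
  by have := subset_leq_card R1P; clear - w1 w2; lia.
(* If [z] is off [D0], it is odd in [P], so it is [a], and [P = R1] is disjoint from [D0]. Then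
   adding [e1] and [D] to [P] gives a join of [a] and [y] whose weight is smaller by 1. *)
have za : z = a.
  have : bd P z.
    rewrite (bd_setID _ _ P D0) Rz addbT; apply/negP.
    case/bd_inc=> g; rewrite in_setI => /andP[_ gD0] gz; case/negP: noinc.
    by apply/exists_inP; exists g.
  by rewrite bdP (negbTE nzb) addbF => /eqP.
have PR1 : P = R1 by apply: min_join_min => // v; rewrite bR1 za addbC.
have dPD : [disjoint P & e1 |: D].
  by rewrite PR1; apply: R1D0; rewrite setUS // subsetUr.
have /minP : join a y (P :|: (e1 |: D)).
  split=> [|v]; first by rewrite !subUset PA sub1set e1A.
  rewrite bd_setU // bd_setU1 // bdP eq1 bD.
  by case: (v == a); case: (v == b); case: (v == x); case: (v == y).
rewrite wt_setU // wt_setU ?disjoints1 // wt_set1 (negbTE e1J) wD2; clear; lia.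
Qed.

End Extremal.

(** Induction on [#|J|], merging [b] with its neighbours and discarding the edges at [b]. Among
    these, [J] has just [e0], and [F] has a nonzero even number, since otherwise [e0] alone would
    cross [[set b]]. *)
Lemma conservative_card (V E : finType) (s t : E -> V) (F J : {set E}) (col : {set V}) :
  [disjoint F & J] ->
  (forall e, e \in F :|: J -> crosses s t col e) ->
  boundary s t F =1 xpred0 ->
  conservative s t (F :|: J) J ->
  (forall S, #|[set e in F :|: J | crosses s t S e]| != 1) ->
  2 * #|J| <= #|F|.
Proof.
elim: {J}_.+1 {-2}J (ltnSn #|J|) s t F col => // n IHn J.
rewrite ltnS => leJn s t F col dFJ colA evF cons nobr.
have [->|nJ] := eqVneq J set0; first by rewrite cards0.
have JA : J \subset F :|: J by rewrite subsetUr.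
have [a [b [P [nab jP wP mP]]]] := min_join JA colA cons nJ.
have [e0 [e0P e0J e0b] e0u] := min_join_end cons nab jP wP mP.
have memP := min_join_end_mem nab jP wP mP.
have contr := min_join_contract colA cons nab jP wP mP.
set nb := nbr s t (F :|: J) b in contr.
pose psi v := if nb v then b else v.
pose F' := [set e in F | ~~ incident s t e b].
pose J' := [set e in J | ~~ incident s t e b].
pose s' := psi \o s; pose t' := psi \o t.
have FJ' : F' :|: J' = [set e in F :|: J | ~~ incident s t e b].
  by apply/setP => e; rewrite !inE andb_orl.
have psib e : e \in F :|: J -> incident s t e b -> s' e = b /\ t' e = b.
  move=> eA eb; rewrite /s' /t' /= /psi.
  have nbi v : incident s t e v -> nb v.
    by move=> ev; apply/exists_inP; exists e => //; rewrite eb.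
  have := colA e eA; rewrite /crosses => cr.
  have nst : s e != t e by apply: contraTneq cr => ->; rewrite addbb.
  by rewrite !nbi // /incident eqxx ?[t e == s e]eq_sym (negbTE nst).
have crossE S e : crosses s' t' S e = crosses s t [set v | psi v \in S] e.
  by rewrite /crosses !inE.
have bdE D u : boundary s' t' D u = \big[addb/false]_(v | psi v == u) boundary s t D v.
  transitivity (\big[addb/false]_(v in [set v | psi v == u]) boundary s t D v).
    rewrite big_bd; apply: eq_bigr => e _; rewrite /crosses /incident !inE //.
  by apply: eq_bigl => v; rewrite inE.
have cardJ : #|J| = #|J'|.+1.
  rewrite (cardsD1 e0) e0J add1n; congr _.+1; apply: eq_card => e; rewrite !inE andbC.
  case: (boolP (e \in J)) => //= eJ; congr (~~ _); apply/eqP/idP => [->//|eb].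
  by apply: e0u; rewrite // memP // inE eJ orbT.
have cardF : #|F'| + 2 <= #|F|.
  rewrite -(cardsID [set e | incident s t e b] F) addnC leq_add //; last first.
    by apply: subset_leq_card; apply/subsetP => e; rewrite !inE andbC.
  set Fb := F :&: _.
  have oFb : ~~ odd #|Fb|.
    have := evF b; rewrite /boundary odd_big_addb.
    by rewrite (_ : [set e in F | _] = Fb) => [->//|]; apply/setP=> e; rewrite !inE.
  have : #|Fb| != 0.
    apply: contra (nobr [set b]); rewrite cards_eq0 => /eqP Fb0.
    rewrite (_ : [set e in _ | _] = [set e0]) ?cards1 //.
    apply/setP => e; rewrite !inE /crosses !inE -[_ (+) _]/(incident s t e b).
    apply/andP/eqP => [[/orP[eF|eJ] eb]|->]; last by rewrite e0J orbT.
      by move/setP/(_ e): Fb0; rewrite !inE eF eb.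
    by apply: e0u; rewrite // memP // inE eJ orbT.
  by case: #|Fb| oFb => [|[|]].
suff : 2 * #|J'| <= #|F'| by lia.
(* All neighbours of [b] have the colour opposite to that of [b]; the merged vertex takes it
   over. *)
apply: (IHn J' _ s' t' F' [set v | if v == b then b \notin col else v \in col]).
- by rewrite cardJ in leJn.
- rewrite disjoints_subset; apply/subsetP => e; rewrite !inE => /andP[eF _].
  by rewrite negb_and (disjointFr dFJ eF).
- move=> e; rewrite FJ' inE => /andP[eA neb]; have := colA e eA.
  have colnb v : v != b -> nb v -> (v \in col) = (b \notin col).
    move=> nvb /exists_inP[f fA /andP[fb fv]].
    by apply: cross_inc fb fv (colA f fA); rewrite eq_sym.
  have colpsi v : v != b ->
      (psi v \in [set v | if v == b then b \notin col else v \in col]) = (v \in col).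
    move=> nvb; rewrite inE /psi; case: (boolP (nb v)) => [/(colnb _ nvb) ->|_].
      by rewrite eqxx.
    by rewrite (negbTE nvb).
  move=> cr; have nst : s e != t e by apply: contraTneq cr => h; rewrite /crosses h addbb.
  have [nsb ntb] : s e != b /\ t e != b.
    by move: neb nst; rewrite /incident; do 2!case: eqVneq => // ->.
  by rewrite /crosses !colpsi.
- move=> u; have := bdE F u; rewrite [RHS]big1 => [|v _]; last exact: evF.
  rewrite (bd_setID _ _ F F') (@bd_noinc _ _ _ _ (F :\: F')) ?addbF.
    by rewrite (setIidPr _) //; apply/subsetP => e; rewrite inE => /andP[].
  move=> e; rewrite !inE => /andP[+ eF]; rewrite eF /= negbK => eb.
  have [|se te] := psib e _ eb; first by rewrite inE eF.
  by rewrite /incident se te addbb.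
- rewrite FJ' => D DA' evD.
  have DA : D \subset F :|: J by apply/subsetP => e /(subsetP DA'); rewrite inE => /andP[].
  have Db e : e \in D -> ~~ incident s t e b by move/(subsetP DA'); rewrite inE => /andP[].
  have -> : weight J' D = weight J D.
    rewrite /weight (_ : D :&: J' = D :&: J) //; apply/setP => e; rewrite !inE.
    by case: (boolP (e \in D)) => //= /Db ->; rewrite andbT.
  apply: contr => // v; apply: contraTT => nv.
  have [->|nvb] := eqVneq v b; first by rewrite (bd_noinc Db).
  have := evD v; rewrite bdE (big_pred1 v) => [->//|x].
  rewrite /psi /=; case: ifP => // nx; rewrite eq_sym (negbTE nvb).
  by apply/esym; apply: contraNF nv => /eqP <-.
move=> S; rewrite FJ'; apply: contra (nobr [set v | psi v \in S]) => /eqP <-; apply/eqP.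
apply: eq_card => e; rewrite [in LHS]inE [in RHS]inE crossE.
rewrite inE -andbA; case: (boolP (e \in F :|: J)) => //= eA.
case: (boolP (incident s t e b)) => //= eb; apply/negbTE.
have [/= se te] := psib e eA eb; rewrite /crosses !inE.
by rewrite -[psi (s e)]/(s' e) -[psi (t e)]/(t' e) se te addbb.
Qed.

(** * Subdivision, and even sets with two thirds of the edges *)

Section Subdivision.
Variables (V E : finType) (s t : E -> V).

(** [inr e] is the midpoint of the edge [e]; the half [(e, true)] runs to [s e] and [(e, false)] to
    [t e]. *)
Definition sub_src (p : E * bool) : V + E := inr p.1.
Definition sub_tgt (p : E * bool) : V + E := inl (if p.2 then s p.1 else t p.1).
Definition halves (D : {set E}) : {set E * bool} := [set p | p.1 \in D].

Lemma card_halves D : #|halves D| = 2 * #|D|.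
Proof.
rewrite (_ : halves D = setX D [set: bool]); first by rewrite cardsX cardsT card_bool mulnC.
by apply/setP => -[e c]; rewrite !inE andbT.
Qed.

Lemma big_halves (G : E * bool -> bool) :
  \big[addb/false]_p G p = \big[addb/false]_e (G (e, true) (+) G (e, false)).
Proof.
transitivity (\big[addb/false]_p G (p.1, p.2)); first by apply: eq_bigr => -[].
rewrite -(pair_bigA _ (fun e c => G (e, c))).
by apply: eq_bigr => e _; rewrite big_bool.
Qed.

Lemma bd_sub_inl (D2 : {set E * bool}) v : boundary sub_src sub_tgt D2 (inl v) =
  \big[addb/false]_e (((e, true) \in D2) && (s e == v) (+) ((e, false) \in D2) && (t e == v)).
Proof.
rewrite /boundary big_mkcond big_halves; apply: eq_bigr => e _.
by rewrite /incident /=; do 2!case: ifP.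
Qed.

Lemma bd_sub_inr (D2 : {set E * bool}) e :
  boundary sub_src sub_tgt D2 (inr e) = ((e, true) \in D2) (+) ((e, false) \in D2).
Proof.
rewrite /boundary big_mkcond big_halves (bigD1 e) //= big1 => [|f nf]; last first.
  rewrite /incident /=.
  have -> : (inr f == inr e :> V + E) = false by apply/negbTE.
  by do 2!case: ifP.
by rewrite addbF /incident /= eqxx; do 2!case: ifP.
Qed.

Lemma bd_halves D v : boundary sub_src sub_tgt (halves D) (inl v) = boundary s t D v.
Proof.
rewrite bd_sub_inl /boundary [RHS]big_mkcond; apply: eq_bigr => e _.
by rewrite !inE /incident; case: (e \in D).
Qed.

(** Evenness at a midpoint forces both halves of the edge or none. *)
Lemma even_halves (D2 : {set E * bool}) : boundary sub_src sub_tgt D2 =1 xpred0 ->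
  exists2 D, D2 = halves D & boundary s t D =1 xpred0.
Proof.
move=> evD2; have eqD2 : D2 = halves [set e | (e, true) \in D2].
  apply/setP => -[e c]; rewrite !inE /=; case: c => //.
  by have := evD2 (inr e); rewrite bd_sub_inr; do 2!case: (_ \in D2).
by exists [set e | (e, true) \in D2] => // v; rewrite -bd_halves -eqD2.
Qed.

Lemma bridgeless_even_subset (A : {set E}) :
  (forall S, #|[set e in A | crosses s t S e]| != 1) ->
  exists F : {set E}, [/\ F \subset A, boundary s t F =1 xpred0 & 2 * #|A| <= 3 * #|F|].
Proof.
move=> nobr; pose ev (D : {set E}) := (D \subset A) && [forall v, ~~ boundary s t D v].
have ev0 : ev set0 by rewrite /ev sub0set; apply/forallP => v; rewrite bd_set0.
case: (arg_maxnP (fun D : {set E} => #|D|) ev0) => F /andP[FA /forallP evF] maxF.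
have {}evF : boundary s t F =1 xpred0 by move=> v; apply/negbTE.
exists F; split=> //; pose J := A :\: F.
have halvesU : halves F :|: halves J = halves A.
  by apply/setP => p; rewrite !inE; have := subsetP FA p.1; case: (_ \in F) => // /(_ isT) ->.
suff : 2 * #|halves J| <= #|halves F|.
  by rewrite !card_halves /J cardsD (setIidPr FA); have := subset_leq_card FA; clear; lia.
(* The midpoints form one colour class of the subdivision. *)
apply: (@conservative_card _ _ sub_src sub_tgt _ _ [set x | if x is inr _ then true else false]).
- rewrite disjoints_subset; apply/subsetP => p; rewrite !inE.
  by move=> ->.
- by move=> [e c] _; rewrite /crosses !inE.
- move=> [v|e]; first by rewrite bd_halves evF.
  by rewrite bd_sub_inr !inE addbb.
- rewrite halvesU => D2 D2A /even_halves[D eqD evD].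
  have DA : D \subset A by apply/subsetP => e eD; have /(subsetP D2A) : (e, true) \in D2; rewrite ?eqD inE.
  have -> : weight (halves J) D2 = ((2 * #|D|)%:Z - (2 * (2 * #|D :&: J|))%:Z)%R.
    rewrite /weight eqD -!card_halves (_ : halves D :&: halves J = halves (D :&: J)) //.
    by apply/setP => p; rewrite !inE.
  (* Maximality of [F] gives [#|D :\: F| <= #|D :&: F|], which is conservativity for [D]. *)
  have : #|symdiff F D| <= #|F|.
    apply: maxF; rewrite /ev subUset !(subset_trans (subsetDl _ _)) //=.
    by apply/forallP => v; rewrite bd_symdiff evF evD.
  rewrite /symdiff cardsU (_ : _ :&: _ = set0) ?cards0; last first.
    by apply/setP => e; rewrite !inE; do 2!case: (_ \in _).
  have -> : D :&: J = D :\: F.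
    by apply/setP => e; rewrite !inE; have := subsetP DA e; case: (e \in D) => [/(_ isT) -> //|_]; rewrite andbF.
  have := cardsID D F; have := cardsID F D; rewrite (setIC D F).
  by clear; lia.
move=> S2; apply/negP => /cards1P[[e c] eqS].
have eA : e \in A.
  by move/setP/(_ (e, c)): (eqS); rewrite halvesU !inE eqxx => /andP[].
have {}eqS p : p.1 \in A -> crosses sub_src sub_tgt S2 p = (p == (e, c)).
  by move=> pA; move/setP/(_ p): eqS; rewrite halvesU !inE pA.
(* An edge crosses [S] when exactly one of its halves crosses [S2], so a single crossing half yields
   a single crossing edge. *)
pose S := [set v | inl v \in S2]; case/negP: (nobr S); apply/cards1P; exists e.
have crossE f : crosses s t S f = crosses sub_src sub_tgt S2 (f, true) (+) crosses sub_src sub_tgt S2 (f, false).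
  by rewrite /crosses /= !inE; do 3!case: (_ \in S2).
apply/setP => f; rewrite !inE crossE; case: (boolP (f \in A)) => [fA|nfA] /=; last first.
  by apply/esym; apply: contraNF nfA => /eqP ->.
by rewrite !eqS // !xpair_eqE; case: (f == e); case: (c).
Qed.
End Subdivision.

(** A subset of [C] is determined by its boundary, by acyclicity, and the boundary by its values off
    [s e0], by the handshake identity. So [2 ^ #|C| <= 2 ^ (#|T| - 1)]. *)
Lemma forest_card (V E : finType) (s t : E -> V) (C : {set E}) :
  (forall D : {set E}, D \subset C -> boundary s t D =1 xpred0 -> D = set0) -> C != set0 ->
  #|C| < #|[set v | [exists e in C, (s e == v) || (t e == v)]]|.
Proof.
move=> acyc /set0Pn[e0 e0C]; set T := [set v | _].
have v0T : s e0 \in T by rewrite inE; apply/exists_inP; exists e0; rewrite ?eqxx.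
have bdT (D : {set E}) v : D \subset C -> boundary s t D v -> v \in T.
  move=> DC /bd_inc[e /(subsetP DC) eC]; rewrite inE /incident => h.
  by apply/exists_inP; exists e => //; move: h; do 2!case: (_ == _).
pose g (D : {set E}) := [set v in T :\ s e0 | boundary s t D v].
have injg : {in powerset C &, injective g}.
  move=> D1 D2; rewrite !inE => sD1 sD2 /setP eqg.
  have XC : symdiff D1 D2 \subset C by rewrite subUset !(subset_trans (subsetDl _ _)).
  have bX v : v != s e0 -> boundary s t (symdiff D1 D2) v = false.
    move=> nv; apply/negP => bv; have vT := bdT _ _ XC bv; have := eqg v.
    by rewrite !inE nv /=; move: vT bv; rewrite inE bd_symdiff => -> /=; do 2!case: boundary.
  have : symdiff D1 D2 = set0.
    apply: acyc => // v; have [->|/bX//] := eqVneq v (s e0).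
    have := handshake s t (symdiff D1 D2); rewrite (bigD1 (s e0)) //= big1 ?addbF //.
  move=> /setP sd; apply/setP => e; have := sd e; rewrite !inE.
  by do 2!case: (_ \in _).
have := subset_leq_card (_ : g @: powerset C \subset powerset (T :\ s e0)).
rewrite (card_in_imset injg) !card_powerset leq_exp2l // [#|T|](cardsD1 (s e0)) v0T.
apply; apply/subsetP => X /imsetP[D _ ->]; rewrite inE.
by apply/subsetP => v; rewrite inE => /andP[].
Qed.

(** * Degrees, connectivity and cut-edges *)

Section Multigraph.
Variable G : multigraph.
Local Notation s := (@src G).
Local Notation t := (@tgt G).
Local Notation bd := (boundary s t).
Local Notation cross := (crosses s t).
Implicit Types (D F : {set edge G}) (S : {set vert G}) (e f : edge G) (v x y : vert G).

Lemma odd_deg D v : odd (deg D v) = bd D v.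
Proof. by rewrite /deg oddD -!odd_big_addb -big_split. Qed.

Lemma deg_sub D F v : D \subset F -> deg D v <= deg F v.
Proof.
move=> sDF; apply: leq_add; apply: subset_leq_card; apply/subsetP => e; rewrite !inE;
  by case/andP=> /(subsetP sDF) -> ->.
Qed.

Lemma sum_card_fiber (I J : finType) (h : I -> J) (X : {set I}) (Y : {set J}) :
  \sum_(j in Y) #|[set i in X | h i == j]| = #|[set i in X | h i \in Y]|.
Proof.
rewrite -sum1_card (partition_big h (mem Y)) => [|i]; last by rewrite inE => /andP[].
apply: eq_bigr => j jY; rewrite -sum1_card; apply: eq_bigl => i.
by rewrite !inE -andbA; case: eqP => [->|_]; rewrite ?jY ?andbF.
Qed.

Lemma sum_deg F S : \sum_(v in S) deg F v =
  #|[set e in F | s e \in S]| + #|[set e in F | t e \in S]|.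
Proof. by rewrite big_split !sum_card_fiber. Qed.

Lemma adj_sym F : symmetric (adj F).
Proof. by move=> x y; apply: eq_existsb => e; rewrite orbC. Qed.

Lemma adj_connect_sym F : connect_sym (adj F).
Proof. exact/sym_connect_sym/adj_sym. Qed.

Lemma adj_edge F e : e \in F -> adj F (s e) (t e).
Proof. by move=> eF; apply/exists_inP; exists e; rewrite ?eqxx. Qed.

Lemma connect_adj_sub D F : D \subset F -> subrel (connect (adj D)) (connect (adj F)).
Proof.
move=> sDF; apply: connect_sub => x y /exists_inP[e /(subsetP sDF) eF h].
by apply: connect1; apply/exists_inP; exists e.
Qed.

(** If the ends of [e] stay connected, the components do not change. Otherwise the roots after the
    deletion map onto the roots before it, and the distinct roots of the two ends have the same
    image. *)
Lemma cut_edgesE e : (e \in cut_edges G) = ~~ connect (adj [set~ e]) (s e) (t e).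
Proof.
rewrite inE /num_components.
set rT := adj [set: edge G]; set re := adj [set~ e].
have subc : subrel (connect re) (connect rT) by apply: connect_adj_sub; apply: subsetT.
have [conn|nconn] := boolP (connect re _ _).
  apply/negbTE; rewrite -leqNgt (@eq_n_comp _ re rT) // => x y.
  apply/idP/idP; first exact: subc.
  apply: connect_sub => {}x {}y /exists_inP[f _].
  have [->|nf] := eqVneq f e; last first.
    by move=> h; apply: connect1; apply/exists_inP; exists f; rewrite ?inE.
  by case/orP=> /andP[/eqP <- /eqP <-] //; rewrite (adj_connect_sym [set~ e]).
rewrite /n_comp_mem.
pose h := fingraph.root rT; pose q := fingraph.root re.
have syT := adj_connect_sym [set: edge G]; have sye := adj_connect_sym [set~ e].
have hq x : h (q x) = h x.
  by apply/eqP; rewrite (root_connect syT) syT; apply/subc/connect_root.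
have hst : h (s e) = h (t e).
  by apply/eqP; rewrite (root_connect syT); apply/connect1/adj_edge.
have nq : q (s e) != q (t e) by rewrite (root_connect sye).
pose X := [set x | x \in fingraph.roots re].
have cX : #|[predI fingraph.roots re & predT]| = #|X|.
  by apply: eq_card => x; rewrite !inE andbT.
have qX x : q x \in X by rewrite inE; apply: roots_root.
rewrite cX [#|X|](cardsD1 (q (t e))) qX add1n ltnS.
apply: leq_trans (leq_imset_card h _); apply: subset_leq_card; apply/subsetP => x.
rewrite !inE andbT => /eqP rx.
have [qx|nqx] := eqVneq (q x) (q (t e)).
  apply/imsetP; exists (q (s e)); first by rewrite in_setD1 nq qX.
  by rewrite hq hst -hq -qx hq.
by apply/imsetP; exists (q x); rewrite ?in_setD1 ?nqx ?qX // hq.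
Qed.

Lemma adj_closed D S x y : (forall e, e \in D -> ~~ cross S e) ->
  connect (adj D) x y -> (x \in S) = (y \in S).
Proof.
move=> ncr /connectP[p pth ->]; elim: p x pth => //= z p IHp x /andP[/exists_inP[e eD h] pth].
rewrite -(IHp z pth); have := ncr e eD; rewrite /crosses negb_add => /eqP eqS.
by case/orP: h => /andP[/eqP <- /eqP <-].
Qed.

Lemma connect_join D x y : connect (adj D) x y ->
  exists2 Q : {set edge G}, Q \subset D & forall v, bd Q v = (v == x) (+) (v == y).
Proof.
move=> /connectP[p pth ->]; elim: p x pth => [|z p IHp] x /=.
  by move=> _; exists set0; rewrite ?sub0set // => v; rewrite bd_set0 addbb.
case/andP=> /exists_inP[e eD h] /IHp[Q sQ bQ]; exists (symdiff Q [set e]).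
  by rewrite subUset (subset_trans (subsetDl _ _) sQ) (subset_trans (subsetDl _ _)) ?sub1set.
move=> v; rewrite bd_symdiff bQ bd_set1 /incident.
case/orP: h => /andP[/eqP -> /eqP ->]; rewrite ![_ == v]eq_sym;
  by case: (v == x); case: (v == z); case: (v == last _ _).
Qed.

(** Otherwise the component of [x] would contain exactly one odd vertex. *)
Lemma join_connect D x y : (forall v, bd D v = (v == x) (+) (v == y)) -> connect (adj D) x y.
Proof.
move=> bD; have [->|nxy] := eqVneq x y; first exact: connect0.
apply/idPn => nc; pose S := [set v | connect (adj D) x v].
have : \big[addb/false]_(v in S) bd D v = false.
  rewrite big_bd big1 // => e eD; rewrite /crosses !inE.
  have c1 := connect1 (adj_edge eD).
  by rewrite (same_connect_r (adj_connect_sym D) c1) addbb.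
rewrite (bigD1 x) /= ?inE ?connect0 // bD eqxx (negbTE nxy) big1 // => v.
rewrite inE bD => /andP[xv /negbTE ->]; rewrite addFb.
by apply: contraNF nc => /eqP <-.
Qed.

(** A path between the ends of [e] that avoids [e] is closed by [e] to an even set. *)
Lemma noncut_even e : e \notin cut_edges G -> exists2 D : {set edge G}, e \in D & bd D =1 xpred0.
Proof.
rewrite cut_edgesE negbK => /connect_join[Q sQ bQ]; exists (e |: Q); first by rewrite setU11.
move=> v; rewrite bd_setU1; last by apply/negP => /(subsetP sQ); rewrite !inE eqxx.
by rewrite bQ /incident ![_ == v]eq_sym addbb.
Qed.

Lemma even_noncut D e : bd D =1 xpred0 -> e \in D -> e \notin cut_edges G.
Proof.
move=> evD eD; rewrite cut_edgesE negbK.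
apply: (@connect_adj_sub (D :\ e)); first by apply/subsetP => f; rewrite !inE => /andP[].
apply: join_connect => v.
by rewrite bd_setD1 // evD /incident ![_ == v]eq_sym.
Qed.

Lemma cut_cross e : e \in cut_edges G -> exists S, cross S =1 pred1 e.
Proof.
rewrite cut_edgesE => nc; exists [set v | connect (adj [set~ e]) (s e) v] => f.
rewrite /crosses !inE /=; have [->|nf] := eqVneq f e; first by rewrite connect0 (negbTE nc).
have fe : f \in [set~ e] by rewrite !inE.
by rewrite (same_connect_r (adj_connect_sym _) (connect1 (adj_edge fe))) addbb.
Qed.

Lemma big_pred1_addb D e : \big[addb/false]_(f in D) (f == e) = (e \in D).
Proof.
have [eD|neD] := boolP (e \in D).
  by rewrite (bigD1 e) //= eqxx big1 // => f /andP[_ /negbTE].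
by rewrite big1 // => f fD; apply/negbTE; apply: contraNneq neD => <-.
Qed.

Lemma cross_cut e S : cross S =1 pred1 e -> e \in cut_edges G.
Proof.
move=> crS; apply/idPn => /noncut_even[D eD evD].
have := even_cross S evD; rewrite (eq_bigr (fun f => f == e)) => [|f _]; last exact: crS.
by rewrite big_pred1_addb eD.
Qed.

End Multigraph.

(** * The blocks left by deleting the cut-edges, and the lower bound *)

Section Blocks.
Variable G : multigraph.
Local Notation s := (@src G).
Local Notation t := (@tgt G).
Local Notation bd := (boundary s t).
Local Notation cross := (crosses s t).
Local Notation C := (cut_edges G).
Implicit Types (D F : {set edge G}) (S : {set vert G}) (e f : edge G) (v x y B : vert G).

(** A block is named by its canonical root; a vertex that is not a root names an empty block, so
    sums over blocks may range over all vertices. *)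
Definition block v := fingraph.root (adj (~: C)) v.

Definition block_edges B := [set e in ~: C | block (s e) == B].

Definition block_cuts B :=
  #|[set e in C | block (s e) == B]| + #|[set e in C | block (t e) == B]|.

Lemma block_edgesE B e : (e \in block_edges B) = (e \notin C) && (block (s e) == B).
Proof. by rewrite in_set in_setC. Qed.

Lemma block_noncut e : e \notin C -> block (s e) = block (t e).
Proof.
move=> eC; apply/eqP; rewrite (root_connect (adj_connect_sym _)).
by apply/connect1/adj_edge; rewrite in_setC.
Qed.

Lemma block_edges_inc B e v : e \notin C -> incident s t e v ->
  (e \in block_edges B) = (block v == B).
Proof.
move=> eC; rewrite block_edgesE eC /incident; case: eqP => [->//|_]; case: eqP => [<- _|//].
by rewrite (block_noncut eC).
Qed.

(** An even [D] contains no cut-edge, so [block_edges B] contains all edges of [D] incident to a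
    vertex of the block, and none incident to any other vertex. *)
Lemma bd_block_edges B D v : bd D =1 xpred0 -> bd (D :&: block_edges B) v = false.
Proof.
move=> evD; have [vB|vB] := boolP (block v == B).
  rewrite -[RHS](evD v) (bd_setID _ _ D (block_edges B)).
  rewrite (@bd_noinc _ _ _ _ (D :\: _)) ?addbF // => e; rewrite in_setD => /andP[neB eD].
  by apply: contra neB => ev; rewrite (block_edges_inc _ _ ev) // (even_noncut evD).
apply: bd_noinc => e; rewrite in_setI => /andP[eD eB]; apply: contra vB => ev.
by rewrite -(@block_edges_inc B e) // (even_noncut evD).
Qed.

(** An even set through a crossing edge restricts to an even set inside the block, which must cross
    [S] in a second edge. *)
Lemma block_bridgeless B S : #|[set e in block_edges B | cross S e]| != 1.
Proof.
apply/negP => /cards1P[e eqS].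
have /andP[eB eS] : (e \in block_edges B) && cross S e.
  by move/setP/(_ e): eqS; rewrite in_set in_set1 eqxx.
have [D eD evD] : exists2 D : {set edge G}, e \in D & bd D =1 xpred0.
  by apply: noncut_even; move: eB; rewrite block_edgesE => /andP[].
have := even_cross S (fun v => bd_block_edges B v evD).
rewrite (eq_bigr (fun f => f == e)) => [|f]; first by rewrite big_pred1_addb in_setI eD eB.
by rewrite in_setI => /andP[_ fB]; move/setP/(_ f): eqS; rewrite in_set fB in_set1.
Qed.

(** Sets chosen separately in the blocks combine to an even set, because the non-cut edges at a
    vertex all belong to its own block. *)
Lemma blocks_even : exists F, [/\ F \subset ~: C, bd F =1 xpred0 &
  forall B, 2 * #|block_edges B| <= 3 * #|F :&: block_edges B|].
Proof.
have [f fP] := fin_all_exists (fun B => bridgeless_even_subset (block_bridgeless B)).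
have fC B e : e \in f B -> e \notin C /\ block (s e) = B.
  by case: (fP B) => /subsetP h _ _ /h; rewrite block_edgesE => /andP[-> /eqP].
exists [set e | e \in f (block (s e))]; split.
- by apply/subsetP => e; rewrite in_set in_setC => /fC[].
- move=> v; have [_ /(_ v) <- _] := fP (block v).
  rewrite /boundary big_mkcond [RHS]big_mkcond; apply: eq_bigr => e _; rewrite inE.
  have [|_] := boolP (incident s t e v); last by rewrite !if_same.
  rewrite /incident; case: eqP => [->//|_]; case: eqP => [<- _|//]; congr (if _ then _ else _).
  apply/idP/idP => eF; last by case: (fC _ _ eF) => _ ->.
  by rewrite -block_noncut //; case: (fC _ _ eF).
move=> B; have [fB _ le] := fP B; rewrite (leq_trans le) // leq_mul2l subset_leq_card //.
apply/subsetP => e eB; rewrite in_setI (subsetP fB) // andbT inE.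
by case: (fC _ _ eB) => _ ->.
Qed.

Lemma sum_block_cuts : \sum_B block_cuts B = 2 * #|C|.
Proof.
rewrite big_split /=.
have h (g : edge G -> vert G) : \sum_B #|[set e in C | g e == B]| = #|C|.
  rewrite -[RHS](eq_card (_ : [set e in C | g e \in [set: vert G]] =i C)) => [|e].
    by rewrite -sum_card_fiber; apply: eq_bigl => B; rewrite inE.
  by rewrite in_set in_setT andbT.
by rewrite !(h (block \o _)) mul2n addnn.
Qed.

(** Contracting the blocks leaves the cut-edges acyclic: one side of a cut-edge [e] is a union of
    blocks that only [e] leaves, while an even set crosses it an even number of times. *)
Lemma cut_forest : C != set0 -> #|C| < #|[set B | 0 < block_cuts B]|.
Proof.
move=> nC; have := @forest_card _ _ (block \o s) (block \o t) C _ nC.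
rewrite (_ : [set v | _] = [set B | 0 < block_cuts B]); last first.
  apply/setP => B; rewrite !in_set addn_gt0 !card_gt0; apply/exists_inP/orP.
    by case=> e eC /orP[] h; [left|right]; apply/set0Pn; exists e; rewrite in_set eC.
  case=> /set0Pn[e]; rewrite in_set => /andP[eC h]; exists e => //=; rewrite h ?orbT //.
apply=> D DC evD; apply/eqP/idPn => /set0Pn[e eD].
have [S crS] := cut_cross (subsetP DC e eD).
have := even_cross S evD; rewrite (eq_bigr (fun f => f == e)) => [|f _].
  by rewrite big_pred1_addb eD.
rewrite -[RHS]/(pred1 e f) -crS /crosses.
have satS v : (block v \in S) = (v \in S).
  apply/esym/(@adj_closed _ (~: C)); last exact: connect_root.
  move=> f'; rewrite in_setC crS; apply: contra => /eqP ->.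
  exact: subsetP DC e eD.
by rewrite /= !satS.
Qed.

Lemma cubic_even_deg F v : cubic G -> bd F =1 xpred0 -> deg F v = 0 \/ deg F v = 2.
Proof.
move=> cub evF; have := deg_sub v (subsetT F); rewrite cub.
by have := odd_deg F v; rewrite evF; case: deg => [|[|[|[|]]]] //; [left|right].
Qed.

Lemma f2_even F : cubic G -> bd F =1 xpred0 -> #|[set v | deg F v == 2]| <= f2 G.
Proof.
move=> cub evF; apply: (@leq_bigmax_cond _ _ (fun H : {set vert G} * {set edge G} => #|H.1|) (_, F)).
apply/andP; split; last by apply/forall_inP => v; rewrite inE.
apply/forall_inP => e eF; rewrite !inE /=.
have pos (v : vert G) : s e = v \/ t e = v -> deg F v == 2.
  move=> h; case: (cubic_even_deg v cub evF) => [/eqP|-> //].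
  rewrite addn_eq0 !cards_eq0 => /andP[/eqP/setP/(_ e) h1 /eqP/setP/(_ e) h2].
  by move: h1 h2; rewrite !inE eF; case: h => ->; rewrite eqxx.
by rewrite !pos; auto.
Qed.

(** With [m] missed vertices, degree sums give [3 * #|VB| = 2 * #|block_edges B| + block_cuts B] and
    [#|VB| - m = #|F :&: block_edges B|], hence [3 * m <= block_cuts B]. For positive [m], moreover,
    [2 * m + 1 <= 3 * m]. *)
Lemma block_missed F B : cubic G -> F \subset ~: C -> bd F =1 xpred0 ->
  2 * #|block_edges B| <= 3 * #|F :&: block_edges B| ->
  2 * #|[set v | (deg F v != 2) && (block v == B)]| + (0 < block_cuts B) <= block_cuts B.
Proof.
move=> cub FC evF le; pose VB := [set v | block v == B].
have sumF := sum_deg F VB; have sumE := sum_deg [set: edge G] VB.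
have cardF (g : edge G -> vert G) : (forall e, e \notin C -> block (g e) = block (s e)) ->
    #|[set e in F | g e \in VB]| = #|F :&: block_edges B|.
  move=> h; apply: eq_card => e; rewrite in_setI block_edgesE in_set [g e \in _]in_set.
  case: (boolP (e \in F)) => //= eF.
  by have := subsetP FC e eF; rewrite in_setC => eC; rewrite (h e eC) eC.
have cardE (g : edge G -> vert G) : (forall e, e \notin C -> block (g e) = block (s e)) ->
    #|[set e in [set: edge G] | g e \in VB]| = #|block_edges B| + #|[set e in C | block (g e) == B]|.
  move=> h; rewrite addnC -(cardsID C); congr (_ + _); apply: eq_card => e.
    by rewrite in_setI [RHS]in_set [e \in [set _ | _]]in_set in_setT [g e \in _]in_set andbC.
  rewrite in_setD [e \in [set _ | _]]in_set in_setT [g e \in _]in_set block_edgesE.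
  by case: (boolP (e \in C)) => //= eC; rewrite h.
have ht e : e \notin C -> block (t e) = block (s e) by move/block_noncut.
rewrite !cardF // in sumF; rewrite !cardE // in sumE.
rewrite (eq_bigr (fun=> 3)) // sum_nat_const in sumE.
have sumF2 : \sum_(v in VB) deg F v = 2 * #|VB :\: [set v | deg F v != 2]|.
  rewrite (big_setID [set v | deg F v != 2]) /= big1 => [|v]; last first.
    by rewrite !inE => /andP[_]; case: (cubic_even_deg v cub evF) => ->.
  rewrite (eq_bigr (fun=> 2)) => [|v]; last by rewrite !inE negbK => /andP[/eqP].
  by rewrite sum_nat_const mulnC.
have := cardsID [set v | deg F v != 2] VB.
have -> : VB :&: [set v | deg F v != 2] = [set v | (deg F v != 2) && (block v == B)].
  by apply/setP => v; rewrite !inE andbC.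
move: sumE; rewrite -/(block_cuts B) addnACA -/(block_cuts B).
by rewrite sumF2 in sumF; clear - le sumF; case: (block_cuts B) => [|d]; lia.
Qed.

(** Sum [block_missed] over all blocks; for nonempty [C], [cut_forest] makes the extra terms at
    least [#|C| + 1]. Doubling avoids the floor. *)
Lemma cubic_f2 : cubic G -> 2 * #|vert G| + (#|C| != 0) <= 2 * f2 G + #|C|.
Proof.
move=> cub; have [F [FC evF le]] := blocks_even.
have f2F := f2_even cub evF.
have : 2 * #|[set v | deg F v != 2]| + #|[set B | 0 < block_cuts B]| <= 2 * #|C|.
  rewrite -sum_block_cuts.
  have -> : #|[set v | deg F v != 2]| = \sum_B #|[set v | (deg F v != 2) && (block v == B)]|.
    transitivity (\sum_(B in [set: vert G]) #|[set v in [set v | deg F v != 2] | block v == B]|).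
      by rewrite sum_card_fiber; apply: eq_card => v; rewrite !inE andbT.
    by apply: eq_big => [B|B _]; rewrite ?inE //; apply: eq_card => v; rewrite !inE.
  have -> : #|[set B | 0 < block_cuts B]| = \sum_B (0 < block_cuts B : nat).
    by rewrite -sum1_card big_mkcond; apply: eq_bigr => B _; rewrite inE; case: (0 < _).
  rewrite big_distrr -big_split; apply: leq_sum => B _; exact: block_missed.
have cardV : #|[set v | deg F v != 2]| + #|[set v | deg F v == 2]| = #|vert G|.
  rewrite -[RHS](cardC [set v | deg F v != 2]); congr (_ + _); apply: eq_card => v.
  by rewrite !inE negbK.
move: f2F cardV; have [C0|nC] := eqVneq #|C| 0.
  by rewrite C0; clear; lia.
have := cut_forest; rewrite -cards_eq0 nC => /(_ isT).
by clear; lia.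
Qed.

End Blocks.

(** * The extremal caterpillars *)

Section Caterpillar.
Variable k : nat.

(* The end blocks are copies of [K4] with one edge subdivided by the vertex 0. *)
Definition gadget_src (q : 'I_7) : 'I_5 :=
  nth ord0 (map (fun i => inZp i) [:: 0; 0; 1; 1; 2; 2; 3]) q.
Definition gadget_tgt (q : 'I_7) : 'I_5 :=
  nth ord0 (map (fun i => inZp i) [:: 1; 2; 3; 4; 3; 4; 4]) q.

(* The [j]-th of the [k + 2] vertices of the spine, whose two ends lie in the
   blocks [0] and [k + 1]. *)
Definition spine (j : nat) : 'I_k.+2 * 'I_5 + 'I_k :=
  if j is j'.+1 then
    if insub j' is Some i then inr i else inl (ord_max, ord0)
  else inl (ord0, ord0).

(** Edges [inl] lie in the end blocks, [inr (inl j)] is a spine edge, and [inr (inr i)] is the leg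
    from the inner vertex [i] to the block [i.+1]. *)
Definition cat_src (e : 'I_k.+2 * 'I_7 + ('I_k.+1 + 'I_k)) : 'I_k.+2 * 'I_5 + 'I_k :=
  match e with
  | inl (i, q) => inl (i, gadget_src q)
  | inr (inl j) => spine j
  | inr (inr i) => inr i
  end.

Definition cat_tgt (e : 'I_k.+2 * 'I_7 + ('I_k.+1 + 'I_k)) : 'I_k.+2 * 'I_5 + 'I_k :=
  match e with
  | inl (i, q) => inl (i, gadget_tgt q)
  | inr (inl j) => spine j.+1
  | inr (inr i) => inl (inord i.+1, ord0)
  end.

Definition caterpillar : multigraph := Multigraph cat_src cat_tgt.

Lemma spine_inr j (i : 'I_k) : (spine j == inr i) = (j == i.+1).
Proof.
case: j => [|j] //=; case: insubP => [i' _ <-|] //=.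
rewrite -leqNgt => le; apply/esym/negbTE; have := ltn_ord i; lia.
Qed.

Lemma spine_inl j (i : 'I_k.+2) (x : 'I_5) : j <= k.+1 ->
  (spine j == inl (i, x)) = (x == ord0) &&
    ((j == 0) && (i == 0 :> nat) || (j == k.+1) && (i == k.+1 :> nat)).
Proof.
case: j => [|j] /= lejk.
  change (inl (ord0, ord0) == inl (i, x) :> 'I_k.+2 * 'I_5 + 'I_k) with ((ord0, ord0) == (i, x)).
  by rewrite xpair_eqE orbF andbC eq_sym [ord0 == i]eq_sym.
case: insubP => [i' ltj _|] /=.
  by rewrite eqSS (ltn_eqF ltj) andbF.
rewrite -leqNgt => le.
change (inl (ord_max, ord0) == inl (i, x) :> 'I_k.+2 * 'I_5 + 'I_k) with ((ord_max, ord0) == (i, x)).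
rewrite xpair_eqE andbC eq_sym [ord_max == i]eq_sym; congr (_ && _).
by rewrite eqSS (_ : j == k) //; lia.
Qed.

(** Chosen to increase along every edge from source to target, which excludes loops and oppositely
    listed parallel edges. *)
Definition cat_rank (v : 'I_k.+2 * 'I_5 + 'I_k) : nat :=
  match v with
  | inl (i, x) => (if i == 0 :> nat then 0 else k.+1) + x
  | inr i => i.+1
  end.

Lemma cat_rank_spine j : j <= k.+1 -> cat_rank (spine j) = j.
Proof.
case: j => [|j] //= le; case: insubP => [i _ <-|] //=.
rewrite -leqNgt addn0; lia.
Qed.

(** Projection to the spine: gadget edges and legs keep the position, and the spine edge [j] raises
    it from [j] to [j.+1]. *)
Definition cat_pos (v : 'I_k.+2 * 'I_5 + 'I_k) : nat :=
  match v with inl (i, _) => i | inr i => i.+1 end.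

Lemma cat_pos_spine j : j <= k.+1 -> cat_pos (spine j) = j.
Proof.
case: j => [|j] //= le; case: insubP => [i _ <-|] //=; rewrite -leqNgt; lia.
Qed.

Arguments spine : simpl never.

Lemma gadget_rank q : gadget_src q < gadget_tgt q.
Proof. by case: q => -[|[|[|[|[|[|[|]]]]]]] //. Qed.

Lemma gadget_inj q q' : gadget_src q = gadget_src q' -> gadget_tgt q = gadget_tgt q' -> q = q'.
Proof.
move=> /(congr1 val) + /(congr1 val) +; case: q q' => [q lq] [q' lq'].
move=> h1 h2; apply: val_inj => /=; move: h1 h2.
by case: q lq => [|[|[|[|[|[|[|]]]]]]] //; case: q' lq' => [|[|[|[|[|[|[|]]]]]]] //.
Qed.

Lemma cat_rank_lt e : cat_rank (cat_src e) < cat_rank (cat_tgt e).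
Proof.
case: e => [[i q]|[j|i]] /=.
- by rewrite ltn_add2l gadget_rank.
- by rewrite !cat_rank_spine ?(ltnW (ltn_ord j)) ?ltn_ord.
by rewrite inordK /= ?addn0 ?ltnS ?(ltnW (ltn_ord i)) ?ltn_ord.
Qed.

Lemma cat_pair_inj e f : cat_src e = cat_src f -> cat_tgt e = cat_tgt f -> e = f.
Proof.
(* By symmetry the three kinds of edges may be taken in order. *)
wlog : e f / (if e is inl _ then 0 else if e is inr (inl _) then 1 else 2) <=
             (if f is inl _ then 0 else if f is inr (inl _) then 1 else 2).
  by move=> W; case: (leqP _ _) (W e f) => [_|/ltnW le _]; [exact | move=> h1 h2; apply/esym/W].
case: e f => [[i q]|[j|i]] [[i' q']|[j'|i']] //= _.
- by case=> -> h1 [h2]; rewrite (gadget_inj h1 h2).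
- move=> /esym/eqP; rewrite spine_inl; last exact: ltnW (ltn_ord _).
  move=> /andP[_ h] /esym/eqP; rewrite spine_inl; last exact: ltn_ord.
  by move=> /andP[_]; have := ltn_ord j'; move: h; clear; lia.
- move=> /(congr1 cat_rank); rewrite !cat_rank_spine ?(ltnW (ltn_ord _)) // => h _.
  by congr (inr (inl _)); apply: val_inj.
- move=> /eqP; rewrite spine_inr => /eqP h /eqP; rewrite spine_inl; last exact: ltn_ord.
  case/andP=> _; rewrite inordK ?ltnS ?(ltnW (ltn_ord i')) //.
  by have := ltn_ord i'; clear; lia.
by case=> ->.
Qed.

Lemma caterpillar_simple : simple_graph caterpillar.
Proof.
have lt := cat_rank_lt.
split=> [e|e f]; first by apply: contraTneq (lt e) => /= ->; rewrite ltnn.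
move=> /setP ends_eq.
have := ends_eq (cat_src e); have := ends_eq (cat_tgt e); rewrite !inE !eqxx /= orbT.
move=> /esym h1 /esym h2.
have hs : cat_src e = cat_src f.
  case/orP: h2 => /eqP // h2; have := lt e; have := lt f; rewrite h2.
  by case/orP: h1 => /eqP ->; clear; lia.
apply: cat_pair_inj => //; case/orP: h1 => /eqP // h1.
by have := lt e; rewrite h1 hs ltnn.
Qed.

Lemma gadget_deg x : \sum_q ((gadget_src q == x) + (gadget_tgt q == x)) = 3 - (x == ord0).
Proof.
by rewrite !big_ord_recl big_ord0; case: x => -[|[|[|[|[|]]]]].
Qed.

Lemma sum_ord_eq n m : \sum_(j < n) (j == m :> nat) = (m < n).
Proof.
case: ltnP => [lt|le].
  rewrite (bigD1 (Ordinal lt)) //= eqxx big1 // => j.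
  by rewrite -val_eqE /= => /negbTE ->.
by rewrite big1 // => j _; rewrite ltn_eqF // (leq_trans (ltn_ord j)).
Qed.

Lemma deg_sum (G : multigraph) v :
  deg [set: edge G] v = \sum_e ((src e == v) + (tgt e == v)).
Proof.
rewrite big_split /deg; congr (_ + _); rewrite -sum1_card big_mkcond;
  by apply: eq_bigr => e _; rewrite !inE; case: (_ == v).
Qed.

Lemma caterpillar_cubic : cubic caterpillar.
Proof.
move=> v; rewrite deg_sum /= !big_sumType /=.
have -> : \sum_(p : 'I_k.+2 * 'I_7) ((cat_src (inl p) == v) + (cat_tgt (inl p) == v)) =
  if v is inl (i, x) then 3 - (x == ord0) else 0.
  transitivity (\sum_i \sum_q ((inl (i, gadget_src q) == v) + (inl (i, gadget_tgt q) == v))).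
    by rewrite pair_bigA; apply: eq_bigr => -[].
  case: v => [[i x]|i]; last by rewrite big1 // => i' _; rewrite big1.
  rewrite (bigD1 i) //= [X in _ + X]big1 ?addn0 => [|i' ni].
    rewrite -gadget_deg; apply: eq_bigr => q _.
    by congr (_ + _); congr nat_of_bool; apply/eqP/eqP => [[->//]|->].
  rewrite big1 // => q _; apply/eqP; rewrite addn_eq0 !eqb0.
  by apply/andP; split; apply: contra ni => /eqP[->].
case: v => [[i x]|i].
  (* The vertex 0 of a gadget has degree 2 there; blocks [0] and [k.+1] get the missing edge from
     the spine, the others from a leg. *)
  transitivity ((3 - (x == ord0)) +
    ((x == ord0) * ((i == 0 :> nat) + (i == k.+1 :> nat)) + (x == ord0) * (0 < i < k.+1))).
    congr (_ + (_ + _)).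
    - rewrite (eq_bigr (fun j : 'I_k.+1 => (x == ord0) * ((i == 0 :> nat) * (j == 0 :> nat) + (i == k.+1 :> nat) * (j == k :> nat)))).
        by rewrite -big_distrr big_split -!big_distrr /= !sum_ord_eq ltnSn /= !muln1.
      move=> j _; rewrite !spine_inl ?(ltnW (ltn_ord j)) ?ltn_ord //.
      case: (x == ord0) => //=; have := ltn_ord j; clear.
      case: (i == 0 :> nat); case: (i == k.+1 :> nat); rewrite ?andbT ?andbF ?orbF; lia.
    - rewrite (eq_bigr (fun i' : 'I_k => (x == ord0) * ((0 < i) * (i' == i.-1 :> nat)))).
        rewrite -!big_distrr /= sum_ord_eq; congr (_ * _).
        by case: (nat_of_ord i) => //= n; rewrite mul1n.
      move=> i' _; rewrite /= add0n mulnA !mulnb; congr nat_of_bool.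
      have li := ltn_ord i'; apply/eqP/idP => [[<- <-]|/andP[/andP[/eqP-> h] /eqP h']].
        by rewrite eqxx inordK /= ?eqxx // !ltnS (ltnW li).
      by congr (inl (_, _)); apply: val_inj; rewrite /= inordK h' prednK.
  case: (x == ord0) => //=; have := ltn_ord i; clear; lia.
transitivity (0 + ((1 + 1) + 1)) => //; congr (_ + (_ + _)).
  rewrite big_split; congr (_ + _).
    rewrite (eq_bigr (fun j : 'I_k.+1 => (j == i.+1 :> nat) : nat)) => [|j _]; last by rewrite spine_inr.
    by rewrite sum_ord_eq ltnS ltn_ord.
  rewrite (eq_bigr (fun j : 'I_k.+1 => (j == i :> nat) : nat)) => [|j _]; last by rewrite spine_inr eqSS.
  by rewrite sum_ord_eq ltnS ltnW ?ltn_ord.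
rewrite (eq_bigr (fun j : 'I_k => (j == i :> nat) : nat)) => [|j _]; last by rewrite /= addn0.
by rewrite sum_ord_eq ltn_ord.
Qed.

Lemma cat_gadget_noncut i q : (inl (i, q) : edge caterpillar) \notin cut_edges caterpillar.
Proof.
rewrite cut_edgesE negbK; set r := adj _.
have step q' : q' != q -> connect r (inl (i, gadget_src q')) (inl (i, gadget_tgt q')).
  move=> nq; apply/connect1/(@adj_edge caterpillar _ (inl (i, q'))).
  by rewrite !inE; apply: contra nq => /eqP[->].
have sym := adj_connect_sym [set~ (inl (i, q) : edge caterpillar)].
have pets q' : q' != q -> connect r (inl (i, gadget_tgt q')) (inl (i, gadget_src q')).
  by rewrite (sym : connect_sym r); apply: step.
clear sym; clearbody r.
(* In each of the seven cases a path of two or three other gadget edges bypasses [q]. *)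
case: q step pets => -[|[|[|[|[|[|[|//]]]]]]] ltq step pets.
- apply: connect_trans (step (Ordinal (isT : 1 < 7)) isT) _; apply: connect_trans (step (Ordinal (isT : 4 < 7)) isT) _.
  exact: (pets (Ordinal (isT : 2 < 7)) isT).
- apply: connect_trans (step (Ordinal (isT : 0 < 7)) isT) _; apply: connect_trans (step (Ordinal (isT : 2 < 7)) isT) _.
  exact: (pets (Ordinal (isT : 4 < 7)) isT).
- exact: connect_trans (step (Ordinal (isT : 3 < 7)) isT) (pets (Ordinal (isT : 6 < 7)) isT).
- apply: connect_trans (step (Ordinal (isT : 2 < 7)) isT) (step (Ordinal (isT : 6 < 7)) isT).
- apply: connect_trans (step (Ordinal (isT : 5 < 7)) isT) (pets (Ordinal (isT : 6 < 7)) isT).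
- apply: connect_trans (step (Ordinal (isT : 4 < 7)) isT) (step (Ordinal (isT : 6 < 7)) isT).
- apply: connect_trans (pets (Ordinal (isT : 2 < 7)) isT) (step (Ordinal (isT : 3 < 7)) isT).
Qed.

(** A spine edge separates the positions up to [j] from the rest; a leg separates the single block
    [i.+1]. *)
Lemma cat_tree_cut f : (inr f : edge caterpillar) \in cut_edges caterpillar.
Proof.
case: f => [j|i].
  apply: (@cross_cut _ _ [set v : vert caterpillar | cat_pos v <= j]).
  case=> [[i q]|[j'|i]]; rewrite /crosses !inE /=.
  - by rewrite addbb.
  - rewrite !cat_pos_spine ?(ltnW (ltn_ord j')) ?ltn_ord //.
    rewrite -[inr _ == inr _]/(j' == j) -val_eqE /=; clear; lia.
  by rewrite inordK ?addbb // !ltnS (ltnW (ltn_ord i)).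
apply: (@cross_cut _ _ [set v : vert caterpillar | if v is inl (i', _) then i' == i.+1 :> nat else false]).
have spineS j : j <= k.+1 -> (if spine j is inl (i', _) then i' == i.+1 :> nat else false) = false.
  move=> le; case E: (spine j) => [[i' x]|//]; move/eqP: E; rewrite spine_inl //.
  by have := ltn_ord i; clear; lia.
case=> [[i' q]|[j'|i']]; rewrite /crosses !inE /=.
- by rewrite addbb.
- by rewrite !spineS ?(ltnW (ltn_ord j')) ?ltn_ord.
by rewrite inordK ?eqSS // !ltnS (ltnW (ltn_ord i')).
Qed.

Lemma cut_edges_caterpillar : #|cut_edges caterpillar| = (2 * k).+1.
Proof.
have -> : cut_edges caterpillar = inr @: [set: 'I_k.+1 + 'I_k].
  apply/setP => -[[i q]|f]; last by rewrite cat_tree_cut imset_f ?inE.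
  rewrite (negbTE (cat_gadget_noncut i q)); apply/esym/negbTE/negP.
  by case/imsetP.
rewrite card_imset; last by move=> ? ? [].
by rewrite cardsT card_sum !card_ord mul2n -addnn.
Qed.

Lemma caterpillar_f2_le : f2 caterpillar + k <= #|vert caterpillar|.
Proof.
suff : f2 caterpillar <= #|~: (inr @: [set: 'I_k] : {set vert caterpillar})|.
  have := cardsC (inr @: [set: 'I_k] : {set vert caterpillar}).
  rewrite card_imset; last by move=> ? ? [].
  rewrite cardsT card_ord; clear; lia.
apply/bigmax_leqP => -[W F] /= /andP[/forall_inP sub /forall_inP deg2].
have evF : boundary (@src caterpillar) (@tgt caterpillar) F =1 xpred0.
  move=> v; rewrite -odd_deg; have [/deg2/eqP -> //|nW] := boolP (v \in W).
  rewrite (_ : deg F v = 0) //; apply/eqP; rewrite addn_eq0 !cards_eq0.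
  by apply/andP; split; apply/eqP/setP => e; rewrite !inE; apply: contraNF nW
     => /andP[/sub/andP[h1 h2] /eqP <-].
apply: subset_leq_card; apply/subsetP => v vW; rewrite inE.
apply/negP => /imsetP[i _ vi]; have := deg2 v vW; rewrite vi.
(* Being even, [F] avoids the cut-edges, and no gadget edge meets an inner vertex. *)
have h e : e \in F -> exists p, e = inl p.
  by case: e => [p|f] /(even_noncut evF); [exists p | rewrite cat_tree_cut].
suff -> : deg F (inr i : vert caterpillar) = 0 by [].
apply/eqP; rewrite addn_eq0 !cards_eq0; apply/andP; split; apply/eqP/setP => e;
  by rewrite !inE; apply/negP => /andP[/h[[i' q] ->]].
Qed.

End Caterpillar.

(** * The bound with the integer floor, and its sharpness *)

Local Open Scope ring_scope.

Theorem theorem1p1 :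
  (forall (G : multigraph) (n c : nat),
     cubic G -> #|vert G| = n -> #|cut_edges G| = c ->
     n%:Z - Num.max 0 ((c%:Z - 1) %/ 2)%Z <= (f2 G)%:Z)
  /\
  (forall c : nat, (1 <= c)%N -> odd c ->
     exists G : multigraph,
       [/\ simple_graph G, cubic G, #|cut_edges G| = c &
           (f2 G)%:Z = #|vert G|%:Z - Num.max 0 ((c%:Z - 1) %/ 2)%Z]).
Proof.
split=> [G n c cub <- <-|c c1 oc].
  (* For [c = 0] the integer quotient is -1, so the maximum is 0. *)
  by have := cubic_f2 cub; clear; lia.
(* The caterpillar with [c./2] inner vertices misses at least [c./2] vertices, which is the floor of
   half of [c - 1]. *)
have -> : c = (2 * c./2).+1 by rewrite mul2n -[LHS]odd_double_half oc.
exists (caterpillar c./2).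
have cub := @caterpillar_cubic c./2; have cutc := cut_edges_caterpillar c./2.
split=> //; first exact: caterpillar_simple.
have := caterpillar_f2_le c./2; have := cubic_f2 cub; rewrite cutc.
by clear; lia.
Qed.
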